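(* Let $l, r, n$ be positive integers with $r \mid nl$, let $m = nl/r$, and let $p,q \in [0,1]$. Consider the noisy group testing system with parameters $p,q$. For every $(l,r,n)$-regular pooling graph $G$ and every estimator $\Phi : \{0,1\}^m \to \{0,1\}^n$, the estimation error probability $P_e = \Pr(\Phi(Z) \neq X)$, where $Z = F_G(X)\oplus E$, satisfies $$h(p)+\frac{l}{r}\, h(q) - \frac{l}{r}\, h\big((1-p)^r (1-q) + (1-(1-p)^r)\, q\big) - \frac{1}{n} \le P_e .$$
   Context: $h(x) = -x\log_2 x - (1-x)\log_2(1-x)$ is the binary entropy function (with $0\log_2 0 = 0$). Pooling graph: an $(l,r,n)$-regular pooling graph is a bipartite graph $G$ with $n$ left nodes labeled $1,\dots,n$ and $m = nl/r$ right nodes labeled $1,\dots,m$, in which every left node has degree $l$ and every right node has degree $r$. The neighbor set of right node $j$ is $M(j)=\{i : (i,j) \text{ is an edge}\}$, so $|M(j)|=r$. Noisy system: $X=(X_1,\dots,X_n)$ with $X_i$ i.i.d. Bernoulli, $\Pr(X_i=1)=p$, $\Pr(X_i=0)=1-p$. $F_G(X)=(Y_1,\dots,Y_m)$, where $Y_j$ is the logical OR of the $X_i$, $i\in M(j)$. The noise $E=(E_1,\dots,E_m)$ has i.i.d. Bernoulli components with $\Pr(E_j=1)=q$, $\Pr(E_j=0)=1-q$, and is independent of $X$. The observation is $Z=F_G(X)\oplus E$, where $\oplus$ is componentwise addition modulo 2. *)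

(* Defs.v *)
(* MathComp-Analysis. *)
From HB Require Import structures.
From mathcomp Require Import all_boot all_order all_algebra.
From mathcomp Require Import all_classical all_reals all_analysis.
Set Implicit Arguments.
Unset Strict Implicit.
Unset Printing Implicit Defensive.
Import Order.TTheory GRing.Theory Num.Theory.
Local Open Scope classical_set_scope.
Local Open Scope ring_scope.

Definition log2 (R : realType) (x : R) : R := ln x / ln 2.

(* [ln 0 = 0] in the library, and in any case the factor [0] gives the
   convention [0 * log2 0 = 0]. *)
Definition binary_entropy (R : realType) (x : R) : R :=
  - x * log2 x - (1 - x) * log2 (1 - x).

(* Exact when [r %| n * l], which also follows from double counting the edges
   of a regular pooling graph. *)
Definition num_tests (l r n : nat) : nat := ((n * l) %/ r)%N.

(* Nodes are numbered from 0; a bipartite graph without multiple edges is its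
   biadjacency relation. *)
Record pooling_graph (l r n : nat) := PoolingGraph {
  edge : 'I_n -> 'I_(num_tests l r n) -> bool;
  left_regular : forall i, #|[set j | edge i j]%SET| = l;
  right_regular : forall j, #|[set i | edge i j]%SET| = r }.

Definition pool (l r n : nat) (G : pooling_graph l r n)
    (j : 'I_(num_tests l r n)) : {set 'I_n} :=
  [set i | edge G i j].

Definition test_results (l r n : nat) (G : pooling_graph l r n)
    (x : {ffun 'I_n -> bool}) : {ffun 'I_(num_tests l r n) -> bool} :=
  [ffun j => [exists i in pool G j, x i]].

Definition xor_vec (k : nat) (x y : {ffun 'I_k -> bool}) :
  {ffun 'I_k -> bool} := [ffun i => x i (+) y i].

Definition bernoulli_rv (d : measure_display) (T : measurableType d)
    (R : realType) (P : probability T R) (p : R) (X : {RV P >-> bool}) : Prop :=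
  P [set w | X w = true] = p%:E /\ P [set w | X w = false] = (1 - p)%:E.

Definition mutually_independent (d : measure_display) (T : measurableType d)
    (R : realType) (P : probability T R) (d' : measure_display)
    (T' : measurableType d') (I : finType) (X : I -> {RV P >-> T'}) : Prop :=
  forall (J : {set I}) (B : I -> set T'), (forall i, measurable (B i)) ->
    P (\bigcap_(i in [set i | i \in J]) (X i @^-1` B i)) =
    (\prod_(i in J) P (X i @^-1` B i))%E.

Definition rv_vec (d : measure_display) (T : measurableType d)
    (R : realType) (P : probability T R) (k : nat)
    (X : 'I_k -> {RV P >-> bool}) (w : T) : {ffun 'I_k -> bool} :=
  [ffun i => X i w].

(* The values lie in a finite set with its discrete sigma-algebra, so all
   sets of values are considered. *)
Definition independent_vecs (d : measure_display) (T : measurableType d)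
    (R : realType) (P : probability T R) (k k' : nat)
    (U : T -> {ffun 'I_k -> bool}) (V : T -> {ffun 'I_k' -> bool}) : Prop :=
  forall (A : set {ffun 'I_k -> bool}) (B : set {ffun 'I_k' -> bool}),
    P (U @^-1` A `&` V @^-1` B) = (P (U @^-1` A) * P (V @^-1` B))%E.

Definition observation (d : measure_display) (T : measurableType d)
    (R : realType) (P : probability T R) (l r n : nat)
    (G : pooling_graph l r n) (X : 'I_n -> {RV P >-> bool})
    (E : 'I_(num_tests l r n) -> {RV P >-> bool}) (w : T) :
    {ffun 'I_(num_tests l r n) -> bool} :=
  xor_vec (test_results G (rv_vec X w)) (rv_vec E w).

Definition error_probability (d : measure_display) (T : measurableType d)
    (R : realType) (P : probability T R) (l r n : nat)
    (G : pooling_graph l r n) (X : 'I_n -> {RV P >-> bool})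
    (E : 'I_(num_tests l r n) -> {RV P >-> bool})
    (Phi : {ffun 'I_(num_tests l r n) -> bool} -> {ffun 'I_n -> bool}) :
    \bar R :=
  P [set w | Phi (observation G X E w) <> rv_vec X w].

(* Main.v *)
(* Let f and g be the laws of X and E, let s be the probability that a fixed
   test comes out 0, and put z = F_G(x) (+) e.  Apply Gibbs' inequality to the
   law J(x, e) = f(x) g(e) and the subprobability
     Q(x, e) = w(x | z) * \prod_j sigma(z_j),
   where sigma is the Bernoulli law of a single test and w(x | z) is 1/2 if
   x = Phi(z) and 2^-(n+1) otherwise.  The cross entropy of J and Q is
   m h(s) + 1 + n Pe exactly, while the entropy of J is n h(p) + m h(q), so this
   one inequality combines Fano's inequality with the subadditivity of the
   entropy of Z. *)
Require Import Defs.
From HB Require Import structures.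
From mathcomp Require Import all_boot all_order all_algebra.
From mathcomp Require Import all_classical all_reals all_analysis.
From mathcomp Require Import ring lra.
Set Implicit Arguments.
Unset Strict Implicit.
Unset Printing Implicit Defensive.
Import Order.TTheory GRing.Theory Num.Theory.
Local Open Scope classical_set_scope.
Local Open Scope ring_scope.

(** * Logarithms and Gibbs' inequality *)

Lemma ln_prod (R : realType) (I : finType) (F : I -> R) :
  (forall i, 0 < F i) -> ln (\prod_i F i) = \sum_i ln (F i).
Proof.
move=> F0.
suff [] : 0 < \prod_i F i /\ ln (\prod_i F i) = \sum_i ln (F i) by [].
elim/big_rec2: _ => [|i s t _ [t0 <-]]; first by rewrite ltr01 ln1.
by rewrite mulr_gt0 // lnM // posrE.
Qed.

(** Termwise, [ln t <= t - 1] at [t = v i / u i] bounds the difference of the summands by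
    [v i - u i]. Where [u i = 0] both summands vanish. The support condition rules out the default
    value [ln 0 = 0], which would make the left side too large. *)
Lemma gibbs (R : realType) (I : finType) (u v : I -> R) :
  (forall i, 0 <= u i) -> (forall i, 0 <= v i) ->
  (forall i, 0 < u i -> 0 < v i) -> \sum_i v i <= \sum_i u i ->
  \sum_i u i * ln (v i) <= \sum_i u i * ln (u i).
Proof.
move=> u0 v0 uv le_vu; rewrite -subr_le0 -sumrB.
apply: (@le_trans _ _ (\sum_i (v i - u i))); last by rewrite sumrB subr_le0.
apply: ler_sum => i _; have := u0 i; rewrite le_eqVlt => /orP[/eqP <-|ui].
  by rewrite !mul0r !subr0.
have vi := uv i ui; rewrite -mulrBr -ln_div ?posrE //.
have le_ln : ln (v i / u i) <= v i / u i - 1.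
  rewrite -[X in ln X](addrNK 1) addrC; apply: le_ln1Dx.
  by rewrite ltrBrDr addNr divr_gt0.
apply: le_trans (ler_wpM2l (u0 i) le_ln) _.
by rewrite mulrBr mulr1 mulrCA divff ?mulr1 // gt_eqF.
Qed.

(** * Expectations under Bernoulli product laws *)

Definition bern (R : realType) (p : R) (b : bool) : R := if b then p else 1 - p.

Definition bern_vec (R : realType) (I : finType) (p : R)
  (x : {ffun I -> bool}) : R := \prod_i bern p (x i).

Lemma bern_ge0 (R : realType) (p : R) (b : bool) :
  0 <= p <= 1 -> 0 <= bern p b.
Proof. by case/andP=> p0 p1; case: b => //=; rewrite subr_ge0. Qed.

Lemma bern_vec_ge0 (R : realType) (I : finType) (p : R)
    (x : {ffun I -> bool}) :
  0 <= p <= 1 -> 0 <= bern_vec p x.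
Proof. by move=> hp; apply: prodr_ge0 => i _; exact: bern_ge0. Qed.

(** Independence of coordinates in finite form: distributing the product over the sums makes
    expectations factor. The total mass, the marginals and the OR law below are choices of [F]. *)
Lemma sum_bern_vec_prod (R : realType) (I : finType) (p : R)
    (F : I -> bool -> R) :
  \sum_(x : {ffun I -> bool}) bern_vec p x * \prod_i F i (x i)
  = \prod_i (p * F i true + (1 - p) * F i false).
Proof.
under [RHS]eq_bigr => i _ do
  rewrite -(big_bool _ (fun b => bern p b * F i b)).
by rewrite bigA_distr_bigA; apply: eq_bigr => x _; rewrite -big_split.
Qed.

Lemma sum_bern_vec (R : realType) (I : finType) (p : R) :
  \sum_(x : {ffun I -> bool}) bern_vec p x = 1.
Proof.
rewrite (eq_bigr (fun x => bern_vec p x * \prod_(i : I) 1)); last first.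
  by move=> x _; rewrite big1 ?mulr1.
rewrite (sum_bern_vec_prod p (fun=> fun=> 1)).
by rewrite big1 // => i _; rewrite !mulr1 subrKC.
Qed.

Lemma sum_bern_vec_marginal (R : realType) (I : finType) (p : R)
    (phi : bool -> R) (i : I) :
  \sum_(x : {ffun I -> bool}) bern_vec p x * phi (x i)
  = p * phi true + (1 - p) * phi false.
Proof.
pose F k b := if k == i then phi b else 1.
rewrite (eq_bigr (fun x => bern_vec p x * \prod_k F k (x k))); last first.
  move=> x _; rewrite (bigD1 i) //= /F eqxx big1 ?mulr1 //.
  by move=> k /negbTE ->.
rewrite sum_bern_vec_prod (bigD1 i) //= /F eqxx big1 ?mulr1 //.
by move=> k /negbTE ->; rewrite !mulr1 subrKC.
Qed.

(** The indicator that no coordinate in [A] is set is a product over coordinates, with expectation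
    [(1 - p) ^+ #|A|]; [psi] of the OR is affine in this indicator. *)
Lemma sum_bern_vec_or (R : realType) (I : finType) (p : R) (A : {set I})
    (psi : bool -> R) :
  \sum_(x : {ffun I -> bool}) bern_vec p x * psi [exists i in A, x i]
  = (1 - (1 - p) ^+ #|A|) * psi true + (1 - p) ^+ #|A| * psi false.
Proof.
pose F i b : R := if (i \in A) && b then 0 else 1.
have FE (x : {ffun I -> bool}) :
    \prod_i F i (x i) = if [exists i in A, x i] then 0 else 1.
  case: ifPn => [/existsP[i xi]|/existsPn nx].
    by rewrite (bigD1 i) //= /F xi mul0r.
  by rewrite big1 // => i _; rewrite /F (negbTE (nx i)).
have -> : (1 - p) ^+ #|A| = \prod_i (p * F i true + (1 - p) * F i false).
  rewrite -prodr_const [LHS]big_mkcond /=.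
  apply: eq_bigr => i _; rewrite /F andbF andbT.
  by case: ifP => _; [rewrite mulr0 add0r mulr1 | rewrite !mulr1 subrKC].
rewrite -sum_bern_vec_prod.
rewrite (eq_bigr (fun x => psi true * bern_vec p x + (psi false - psi true) *
  (bern_vec p x * \prod_i F i (x i)))); last first.
  by move=> x _; rewrite FE; case: ifP => _; ring.
by rewrite big_split /= -!mulr_sumr sum_bern_vec; ring.
Qed.

Definition nat_entropy (R : realType) (x : R) : R :=
  - x * ln x - (1 - x) * ln (1 - x).

Lemma sum_bern_vec_ln (R : realType) (I : finType) (p : R) :
  0 <= p <= 1 ->
  \sum_(x : {ffun I -> bool}) bern_vec p x * ln (bern_vec p x)
  = - #|I|%:R * nat_entropy p.
Proof.
move=> hp.
rewrite (eq_bigr (fun x => \sum_i bern_vec p x * ln (bern p (x i))));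
  last first.
  (* The logarithm splits only if all factors are positive; otherwise the weight [bern_vec p x] is
     zero. *)
  move=> x _; rewrite -mulr_sumr; have [->|x0] := eqVneq (bern_vec p x) 0.
    by rewrite !mul0r.
  congr (_ * _); apply: ln_prod => i; rewrite lt_neqAle bern_ge0 // andbT.
  by rewrite eq_sym; move/prodf_neq0: x0 => /(_ i isT).
rewrite exchange_big /=.
rewrite (eq_bigr (fun=> - nat_entropy p)); last first.
  move=> i _; rewrite (sum_bern_vec_marginal p (fun b => ln (bern p b))).
  by rewrite /= /nat_entropy; ring.
by rewrite sumr_const -[LHS]mulr_natl; ring.
Qed.

(** * The observation and the comparison law *)

Lemma sum_ffun_xor (V : nmodType) (k : nat) (y : {ffun 'I_k -> bool})
    (F : {ffun 'I_k -> bool} -> V) :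
  \sum_e F (xor_vec y e) = \sum_z F z.
Proof.
have xorK : involutive (xor_vec y).
  by move=> e; apply/ffunP => i; rewrite !ffunE addKb.
by rewrite [RHS](reindex_inj (inv_inj xorK)).
Qed.

Lemma sum_test_outcome (R : realType) (l r n : nat) (G : pooling_graph l r n)
    (p q : R) (j : 'I_(num_tests l r n)) (phi : bool -> R) :
  let s := (1 - p) ^+ r * (1 - q) + (1 - (1 - p) ^+ r) * q in
  \sum_x \sum_e bern_vec p x * bern_vec q e
    * phi (xor_vec (test_results G x) e j)
  = s * phi false + (1 - s) * phi true.
Proof.
move=> s.
(* [psi c] averages over the noise bit when the noiseless test result is [c]. *)
pose psi c := q * phi (c (+) true) + (1 - q) * phi (c (+) false).
rewrite (eq_bigr (fun x => bern_vec p x * psi [exists i in pool G j, x i])).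
  rewrite sum_bern_vec_or /pool right_regular /psi /= /s; ring.
move=> x _; rewrite /psi -(sum_bern_vec_marginal q
  (fun b => phi ([exists i in pool G j, x i] (+) b)) j).
by rewrite mulr_sumr; apply: eq_bigr => e _; rewrite !ffunE mulrA.
Qed.

(* The comparison distribution for the posterior of [X] given the observation:
   an even mixture of the point mass at the estimate and (up to the mass missing
   at the estimate) the uniform distribution. *)
Definition guess (R : realType) (n : nat) (x0 x : {ffun 'I_n -> bool}) : R :=
  2^-1 * (if x == x0 then 1 else 2^-1 ^+ n).

Lemma guess_gt0 (R : realType) (n : nat) (x0 x : {ffun 'I_n -> bool}) :
  0 < guess R x0 x.
Proof.
by rewrite mulr_gt0 ?invr_gt0 ?ltr0n //; case: ifP; rewrite ?exprn_gt0 ?invr_gt0.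
Qed.

Lemma sum_guess_le1 (R : realType) (n : nat) (x0 : {ffun 'I_n -> bool}) :
  \sum_x guess R x0 x <= 1.
Proof.
(* Adding the uniform mass at [x0] as well gives total mass exactly 1. *)
apply: (@le_trans _ _ (\sum_x 2^-1 * ((x == x0)%:R + 2^-1 ^+ n))).
  apply: ler_sum => x _; rewrite ler_wpM2l ?invr_ge0 //.
  by case: ifP => _; rewrite ?add0r // lerDl exprn_ge0 ?invr_ge0.
rewrite -mulr_sumr big_split /= (bigD1 x0) //= eqxx big1; last first.
  by move=> x /negbTE ->.
rewrite sumr_const card_ffun card_bool card_ord -[(_ ^+ n) *+ _]mulr_natl natrX.
by rewrite -exprMn mulfV ?pnatr_eq0 // expr1n addr0 mulVf ?pnatr_eq0.
Qed.

(** The code length is 1 bit for a correct guess and [n + 1] bits for a wrong one, so its mean is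
    affine in the error probability. *)
Lemma ln_guess (R : realType) (n : nat) (x0 x : {ffun 'I_n -> bool}) :
  ln (guess R x0 x) = - (1 + n%:R * (x0 != x)%:R) * ln 2.
Proof.
have h2 : (2^-1 : R) \is Num.pos by rewrite posrE invr_gt0.
rewrite /guess eq_sym; case: ifP => _ /=.
  by rewrite mulr1 lnV ?posrE //; ring.
by rewrite lnM ?posrE ?exprn_gt0 // lnXn // lnV ?posrE // -mulr_natl; ring.
Qed.

(** * The entropy inequality, in nats and scaled by [n] *)

Lemma estimation_entropy_bound (R : realType) (l r n : nat)
    (G : pooling_graph l r n) (p q : R)
    (Phi : {ffun 'I_(num_tests l r n) -> bool} -> {ffun 'I_n -> bool}) :
  0 <= p <= 1 -> 0 <= q <= 1 ->
  let m := (num_tests l r n)%:R in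
  let s := (1 - p) ^+ r * (1 - q) + (1 - (1 - p) ^+ r) * q in
  n%:R * nat_entropy p + m * nat_entropy q - m * nat_entropy s <=
  (1 + n%:R * \sum_x \sum_e bern_vec p x * bern_vec q e
     * (Phi (xor_vec (test_results G x) e) != x)%:R) * ln 2.
Proof.
move=> hp hq /=; set m := (num_tests l r n)%:R; set s := _ + _ * q.
pose Z x e := xor_vec (test_results G x) e.
pose J (x : {ffun 'I_n -> bool}) (e : {ffun 'I_(num_tests l r n) -> bool}) :=
  bern_vec p x * bern_vec q e.
(* The parameter is [1 - s] because [bern] takes the mass of [true], while [s] is the mass of
   outcome 0. *)
pose S := bern_vec (R := R) (I := 'I_(num_tests l r n)) (1 - s).
pose v x e := guess R (Phi (Z x e)) x * S (Z x e).
have J0 x e : 0 <= J x e by rewrite mulr_ge0 ?bern_vec_ge0.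
have sumJ : \sum_x \sum_e J x e = 1.
  under eq_bigr => x _ do rewrite -mulr_sumr sum_bern_vec mulr1.
  exact: sum_bern_vec.
have marg j phi : \sum_x \sum_e J x e * phi (Z x e j)
    = (1 - s) * phi true + s * phi false.
  by rewrite [RHS]addrC; exact: sum_test_outcome.
have hs : 0 <= 1 - s <= 1.
  have /andP[p0 p1] := hp; have /andP[q0 q1] := hq.
  have t0 : 0 <= (1 - p) ^+ r by rewrite exprn_ge0 // subr_ge0.
  have t1 : (1 - p) ^+ r <= 1 by rewrite exprn_ile1 ?subr_ge0 // gerBl.
  have -> : 1 - s = (1 - p) ^+ r * q + (1 - (1 - p) ^+ r) * (1 - q).
    by rewrite /s; ring.
  rewrite addr_ge0 ?mulr_ge0 ?subr_ge0 //=.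
  have : 0 <= s by rewrite addr_ge0 ?mulr_ge0 ?subr_ge0.
  by rewrite /s; lra.
(* The mass of the value [Z x e j] under the law of test [j] is a sum of nonnegative terms that
   includes [J x e]. This covers degenerate [p] and [q] too. *)
have sigma_gt0 x e j : 0 < J x e -> 0 < bern (1 - s) (Z x e j).
  move=> /lt_le_trans; apply.
  have -> : bern (1 - s) (Z x e j)
      = \sum_x' \sum_e' J x' e' * (Z x' e' j == Z x e j)%:R.
    rewrite (marg j (fun b => (b == Z x e j)%:R)).
    by case: (Z x e j) => /=; ring.
  have term_ge0 x' e' : 0 <= J x' e' * (Z x' e' j == Z x e j)%:R.
    by rewrite mulr_ge0.
  rewrite (bigD1 x) //= (bigD1 e) //= eqxx mulr1 -addrA lerDl.
  by rewrite addr_ge0 ?sumr_ge0 // => x' _; rewrite sumr_ge0.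
have v0 x e : 0 <= v x e by rewrite mulr_ge0 ?bern_vec_ge0 // ltW ?guess_gt0.
have Jv x e : 0 < J x e -> 0 < v x e.
  move=> Jxe; rewrite mulr_gt0 ?guess_gt0 // prodr_gt0 // => j _.
  exact: sigma_gt0.
(* For fixed [x], summing over noise is summing over observations [z]. For fixed [z] the guesses
   then sum to at most 1, and [S] has mass 1. *)
have sumv : \sum_x \sum_e v x e <= 1.
  under eq_bigr => x _ do
    rewrite (sum_ffun_xor _ (fun z => guess R (Phi z) x * S z)).
  rewrite exchange_big /= -(sum_bern_vec 'I_(num_tests l r n) (1 - s)).
  apply: ler_sum => z _; rewrite -mulr_suml.
  by rewrite ler_piMl ?bern_vec_ge0 // sum_guess_le1.
have JlnJ : \sum_x \sum_e J x e * ln (J x e)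
    = - (n%:R * nat_entropy p + m * nat_entropy q).
  rewrite (eq_bigr (fun x => bern_vec p x * ln (bern_vec p x)
      + bern_vec p x * (- m * nat_entropy q))); last first.
    move=> x _; have [x0 | x0] := eqVneq (bern_vec p x) 0.
      by rewrite x0 !mul0r addr0 big1 // => e _; rewrite /J x0 !mul0r.
    have -> : - m * nat_entropy q
        = \sum_e bern_vec (I := 'I_(num_tests l r n)) q e * ln (bern_vec q e).
      by rewrite sum_bern_vec_ln // card_ord.
    transitivity (\sum_e (bern_vec p x * ln (bern_vec p x) * bern_vec q e
      + bern_vec p x * (bern_vec (I := 'I_(num_tests l r n)) q e
        * ln (bern_vec q e)))); last first.
      by rewrite big_split /= -!mulr_sumr sum_bern_vec mulr1.
    apply: eq_bigr => e _; rewrite /J.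
    have [-> | e0] := eqVneq (bern_vec q e) 0.
      by rewrite !(mulr0, mul0r) addr0.
    by rewrite lnM ?posrE ?lt_neqAle ?bern_vec_ge0 ?andbT 1?eq_sym //; ring.
  rewrite big_split /= -mulr_suml sum_bern_vec sum_bern_vec_ln // card_ord.
  by ring.
(* Since [S] is a product, its logarithm is a sum over tests, so only the marginal law of each test
   enters, never their joint law. *)
have Jlnv : \sum_x \sum_e J x e * ln (v x e)
    = - m * nat_entropy s - (1 + n%:R * \sum_x \sum_e J x e
      * (Phi (Z x e) != x)%:R) * ln 2.
  rewrite (eq_bigr (fun x => \sum_e (- ln 2 * J x e
      + - n%:R * ln 2 * (J x e * (Phi (Z x e) != x)%:R)
      + \sum_j J x e * ln (bern (1 - s) (Z x e j))))); last first.
    move=> x _; apply: eq_bigr => e _; rewrite -mulr_sumr.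
    have := J0 x e; rewrite le_eqVlt => /orP[/eqP <-|Jxe].
      by rewrite !(mul0r, mulr0) !addr0.
    rewrite /v lnM ?posrE ?guess_gt0 ?prodr_gt0 //; last first.
      by move=> j _; exact: sigma_gt0.
    rewrite ln_guess /S /bern_vec ln_prod; first by ring.
    by move=> j; exact: sigma_gt0.
  under eq_bigr => x _ do rewrite !big_split /= -(mulr_sumr _ _ _ (- ln 2))
    -(mulr_sumr _ _ _ (- n%:R * ln 2)) [X in _ + X]exchange_big /=.
  rewrite !big_split /= -(mulr_sumr _ _ _ (- ln 2)) sumJ.
  rewrite -(mulr_sumr _ _ _ (- n%:R * ln 2)) [X in _ + X]exchange_big /=.
  rewrite [X in _ + X](eq_bigr (fun=> - nat_entropy s)); last first.
    move=> j _; rewrite (marg j (fun b => ln (bern (1 - s) b))) /=.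
    by rewrite subKr /nat_entropy; ring.
  by rewrite sumr_const card_ord -[X in _ + X]mulr_natl; ring.
have := @gibbs _ _ (fun a => J a.1 a.2) (fun a => v a.1 a.2)
  (fun a => J0 a.1 a.2) (fun a => v0 a.1 a.2) (fun a => @Jv a.1 a.2).
rewrite -!(pair_bigA _ J) -!(pair_bigA _ v) /= sumJ => /(_ sumv).
rewrite -(pair_bigA _ (fun x e => J x e * ln (J x e))).
rewrite -(pair_bigA _ (fun x e => J x e * ln (v x e))) /= JlnJ Jlnv.
by lra.
Qed.

(** * From the probability space to finite sums *)

Lemma probability_finite_valued (R : realType) (d : measure_display)
    (T : measurableType d) (P : probability T R) (I : finType) (W : T -> I)
    (A : pred I) :
  (forall i, measurable (W @^-1` [set i])) ->
  P [set w | A (W w)] = (\sum_(i | A i) P (W @^-1` [set i]))%E.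
Proof.
move=> mW.
have -> : [set w | A (W w)] = \bigcup_(i in [set` A]) W @^-1` [set i].
  by apply/seteqP; split => [w Aw|w [i Ai Wi]] /=; [exists (W w)|rewrite Wi].
rewrite measure_fin_bigcup //; last first.
  by move=> i j _ _ [w [/= <- <-]].
have <- : [set` enum A] = [set` A].
  by apply/seteqP; split => i /=; rewrite mem_enum.
by rewrite -fsbig_seq ?enum_uniq // big_enum.
Qed.

(** Written as an intersection over the full index set to match [mutually_independent]. *)
Lemma rv_vec_preimage (R : realType) (d : measure_display)
    (T : measurableType d) (P : probability T R) (k : nat)
    (X : 'I_k -> {RV P >-> bool}) (x : {ffun 'I_k -> bool}) :
  rv_vec X @^-1` [set x]
  = \bigcap_(i in [set i | i \in [set: 'I_k]%SET]) (X i @^-1` [set x i]).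
Proof.
apply/seteqP; split => [w <- i _|w Xw]; first by rewrite /= ffunE.
by apply/ffunP => i; rewrite ffunE; apply: Xw; rewrite /= inE.
Qed.

Lemma measurable_rv_vec (R : realType) (d : measure_display)
    (T : measurableType d) (P : probability T R) (k : nat)
    (X : 'I_k -> {RV P >-> bool}) (x : {ffun 'I_k -> bool}) :
  measurable (rv_vec X @^-1` [set x]).
Proof.
rewrite rv_vec_preimage; apply: fin_bigcap_measurable => // i _.
by rewrite -[_ @^-1` _]setTI; apply: measurable_funP.
Qed.

Lemma probability_rv_vec (R : realType) (d : measure_display)
    (T : measurableType d) (P : probability T R) (k : nat) (p : R)
    (X : 'I_k -> {RV P >-> bool}) (x : {ffun 'I_k -> bool}) :
  (forall i, bernoulli_rv p (X i)) -> mutually_independent X ->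
  P (rv_vec X @^-1` [set x]) = (bern_vec p x)%:E.
Proof.
move=> Xp Xindep; rewrite rv_vec_preimage Xindep // -prodEFin.
apply: eq_big => [i|i _]; first by rewrite inE.
by have [Xt Xf] := Xp i; case: (x i).
Qed.

(** The error event depends only on the pair of vectors [X] and [E], and each fibre of that pair has
    product mass by the three independence hypotheses. *)
Lemma error_probabilityE (R : realType) (l r n : nat) (p q : R)
    (d : measure_display) (T : measurableType d) (P : probability T R)
    (X : 'I_n -> {RV P >-> bool})
    (E : 'I_(num_tests l r n) -> {RV P >-> bool})
    (G : pooling_graph l r n)
    (Phi : {ffun 'I_(num_tests l r n) -> bool} -> {ffun 'I_n -> bool}) :
  (forall i, bernoulli_rv p (X i)) -> mutually_independent X ->
  (forall j, bernoulli_rv q (E j)) -> mutually_independent E ->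
  independent_vecs P (rv_vec X) (rv_vec E) ->
  error_probability G X E Phi
  = (\sum_x \sum_e bern_vec p x * bern_vec q e
     * (Phi (xor_vec (test_results G x) e) != x)%:R)%:E.
Proof.
move=> Xp Xindep Eq Eindep XE.
pose W w := (rv_vec X w, rv_vec E w).
pose A a := Phi (xor_vec (test_results G a.1) a.2) != a.1.
have WE a : W @^-1` [set a]
    = rv_vec X @^-1` [set a.1] `&` rv_vec E @^-1` [set a.2].
  by case: a => x e; apply/seteqP; split => w /=; rewrite /W => -[-> ->].
have -> : error_probability G X E Phi = P [set w | A (W w)].
  by congr (P _); apply/seteqP; split => w /= /eqP.
rewrite probability_finite_valued; last first.
  by move=> a; rewrite WE; apply: measurableI; exact: measurable_rv_vec.
rewrite (eq_bigr (fun a => (bern_vec p a.1 * bern_vec q a.2)%:E)); last first.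
  move=> a _; rewrite WE XE (probability_rv_vec _ Xp) //.
  by rewrite (probability_rv_vec _ Eq).
rewrite sumEFin big_mkcond pair_bigA /=; congr (_%:E).
by apply: eq_bigr => a _; rewrite /A; case: ifP => _; rewrite ?mulr1 ?mulr0.
Qed.

Theorem theorem2 (R : realType) (l r n : nat)
    (hl : (0 < l)%N) (hr : (0 < r)%N) (hn : (0 < n)%N)
    (hdiv : (r %| n * l)%N)
    (p q : R) (hp : 0 <= p <= 1) (hq : 0 <= q <= 1)
    (d : measure_display) (T : measurableType d) (P : probability T R)
    (X : 'I_n -> {RV P >-> bool})
    (E : 'I_(num_tests l r n) -> {RV P >-> bool})
    (hXp : forall i, bernoulli_rv p (X i))
    (hXindep : mutually_independent X)
    (hEq : forall j, bernoulli_rv q (E j))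
    (hEindep : mutually_independent E)
    (hXE : independent_vecs P (rv_vec X) (rv_vec E))
    (G : pooling_graph l r n)
    (Phi : {ffun 'I_(num_tests l r n) -> bool} -> {ffun 'I_n -> bool}) :
  ((binary_entropy p + l%:R / r%:R * binary_entropy q
    - l%:R / r%:R * binary_entropy
        ((1 - p) ^+ r * (1 - q) + (1 - (1 - p) ^+ r) * q)
    - 1 / n%:R)%:E <= error_probability G X E Phi)%E.
Proof.
rewrite (error_probabilityE G Phi hXp hXindep hEq hEindep hXE) lee_fin.
set Pe := (X in _ <= X).
have := estimation_entropy_bound G Phi hp hq; rewrite /= -/Pe.
have ln2 : 0 < ln 2 :> R by rewrite ln_gt0 // ltr1n.
have n0 : 0 < n%:R :> R by rewrite ltr0n.
have r0 : r%:R != 0 :> R by rewrite pnatr_eq0 -lt0n.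
(* By [hdiv] the truncated division defining [num_tests] is exact. *)
have -> : (num_tests l r n)%:R = n%:R * (l%:R / r%:R) :> R.
  by rewrite mulrA -natrM -(divnK hdiv) natrM mulfK.
have HE x : nat_entropy x = binary_entropy x * ln 2 :> R.
  by rewrite /binary_entropy /log2 /nat_entropy; field; rewrite gt_eqF.
rewrite !HE => le_nPe.
(* After scaling by [n] and [ln 2], the goal and the entropy bound have the same difference of
   sides. *)
rewrite -(ler_pM2l n0) -(ler_pM2r ln2) -subr_ge0.
move: le_nPe; rewrite -subr_ge0; congr (0 <= _).
by field; rewrite gt_eqF.
Qed.
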